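(* Let $G$ be a (finite) transitive permutation group of degree $n>1$ whose point-stabilizer subgroup $H$ is dihedral. Then $|G|<4n^2$. In particular, if $G$ is nilpotent, then $|G|\le n^2$, which is equivalent to $|G|\ge |H|^2$.
   Context: All groups are finite. A permutation group of degree $n$ is a group acting faithfully on a set with $n$ elements. The dihedral group of order $2m$ is $D_{2m}=\langle c,d\mid c^m=1,\ d^2=1,\ c^d=c^{-1}\rangle$, where $c^d=d^{-1}cd$ and $m\ge 2$ (so $D_4\cong C_2\times C_2$ counts as dihedral). *)

(* Defs.v *)
From HB Require Import structures.
From mathcomp Require Import all_boot all_fingroup all_solvable.

Set Implicit Arguments.
Unset Strict Implicit.
Unset Printing Implicit Defensive.

Local Open Scope group_scope.

(* 'D_k is indexed by its order k = 2m. The Klein four-group 'D_4 (m = 2) is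
   dihedral, the groups of order at most 2 are not. *)
Definition is_dihedral (gT : finGroupType) (H : {set gT}) : Prop :=
  exists2 m : nat, (1 < m)%N & H \isog 'D_(m.*2).

Lemma is_dihedral_presentation (gT : finGroupType) (H : {group gT}) :
  is_dihedral H <->
  exists2 m : nat,
    (1 < m)%N & H \isog Grp (c : d : c ^+ m, d ^+ 2, c ^ d = c^-1).
Proof.
have D_pres m : (1 < m)%N ->
    'D_(m.*2) \isog Grp (c : d : c ^+ m, d ^+ 2, c ^ d = c^-1).
  by move=> m_gt1; apply: Grp_dihedral.
split=> -[m m_gt1 isoH]; exists m => //.
  exact: isoGrp_trans isoH (D_pres m m_gt1).
rewrite isogEhom D_pres // -isoH homg_refl /=.
by rewrite isoH isoGrp_hom //; apply: D_pres.
Qed.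

(* Main.v *)
Require Import Defs.
From HB Require Import structures.
From mathcomp Require Import all_boot all_fingroup all_solvable.

Local Open Scope group_scope.

(* Let H be the point stabilizer, of order 2m, and C its rotation subgroup,
   cyclic of order m. As H is core-free in G, so is C, and Lucchini's theorem
   on core-free cyclic proper subgroups gives m < |G : C| = 2n, i.e.
   |G| = 2mn < 4n^2. Lucchini's theorem is derived, by induction on |G|, from
   Zenkov's theorem that minimal intersections of A with the conjugates of B,
   for A and B abelian, lie in the Fitting subgroup.
   If G is nilpotent then H is a 2-group, core-free in P = O_2(G). Some
   P-conjugate of H misses the involution of C, hence meets C trivially; its
   product with C lies in a maximal subgroup of P, so 2m|H| <= |P|. *)

(** * Zenkov's theorem *)

(* By Baer-Suzuki it suffices that x and x ^ y generate a p-group. If A and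
   B :^ y generate a proper subgroup this follows by induction; otherwise
   A :&: B :^ y is central in G, hence contained in B as well. *)
Lemma zenkov (gT : finGroupType) (p : nat) (G A B : {group gT}) (x : gT) :
  abelian A -> abelian B -> A \subset G -> B \subset G ->
  (forall y, y \in G -> A :&: B :^ y \subset A :&: B ->
     A :&: B \subset A :&: B :^ y) ->
  x \in A :&: B -> p.-elt x -> x \in 'O_p(G).
Proof.
have [n] := ubnP #|G|; elim: n => // n IHn in G A B x *.
move=> /ltnSE leGn cAA cBB sAG sBG minAB ABx p_x.
have [Ax Bx] := setIP ABx; have Gx : x \in G by apply: (subsetP sAG).
have cByy y : abelian (B :^ y) by rewrite abelianJ.
have [/exists_inP[y Gy /eqP defG] | noGen] :=
  boolP [exists y in G, A <*> B :^ y == G].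
  have cG : A :&: B :^ y \subset 'C(G).
    rewrite -defG centY subsetI; apply/andP; split.
      exact: subset_trans (subsetIl _ _) cAA.
    exact: subset_trans (subsetIr _ _) (cByy y).
  have sAByB : A :&: B :^ y \subset A :&: B.
    rewrite subsetI subsetIl /=; apply/subsetP=> z ABz.
    have /centP/(_ y Gy) czy := subsetP cG z ABz.
    have [_] := setIP ABz; rewrite mem_conjg.
    by rewrite conjgE invgK mulgA -czy mulgK.
  have cxG : x \in 'C(G).
    by apply: subsetP ABx; apply: subset_trans (minAB y Gy sAByB) cG.
  rewrite -cycle_subG; apply: pcore_max => //.
  by rewrite /normal cycle_subG Gx cents_norm // centsC cycle_subG.
apply: Baer_Suzuki => // y Gy.
set H := (A <*> B :^ y)%G.
have sByG : B :^ y \subset G by rewrite conj_subG.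
have sHG : H \subset G by rewrite join_subG sAG.
have ltHG : #|H| < #|G|.
  apply: proper_card; rewrite properEneq sHG andbT.
  by apply: contra noGen => eqHG; apply/exists_inP; exists y.
have sAH : A \subset H by apply: joing_subl.
(* [B] need not lie in [H], but [A] does: cutting [B] down to [B :&: H] changes no intersection of
   [A] with an [H]-conjugate, so minimality passes to [H]. *)
have eqAH X : A :&: (X :&: H) = A :&: X.
  by rewrite setIA setIAC (setIidPl sAH).
have Op_x : x \in 'O_p(H).
  apply: (IHn H A (B :&: H)%G) => //.
  - exact: leq_trans ltHG leGn.
  - exact: abelianS (subsetIl _ _) cBB.
  - exact: subsetIr.
  - move=> h Hh /=; have Gh := subsetP sHG h Hh.
    rewrite conjIg (conjGid Hh) !eqAH.
    exact: minAB.
  - by rewrite /= !inE Ax Bx (subsetP sAH).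
have Hxy : x ^ y \in H.
  by apply: (subsetP (joing_subr A (B :^ y))); rewrite memJ_conjg.
(* [x] lies in the p-group ['O_p(H)], which the p-element [x ^ y] normalizes. *)
apply: (@pgroupS _ _ ('O_p(H) <*> <[x ^ y]>)).
  rewrite gen_subG; apply/subsetP=> z /set2P[] ->.
    by apply: (subsetP (joing_subl _ _)).
  by apply: (subsetP (joing_subr _ _)); apply: cycle_id.
rewrite /= norm_joinEr; last first.
  by rewrite cycle_subG (subsetP _ _ Hxy) // gFnorm.
by rewrite pgroupM pcore_pgroup [pgroup _ _]p_eltJ.
Qed.

(** * Cores of quotients and intersections of conjugates *)

(** The preimage of the core of [A / K] is normalized by [G] and lies in [A]. *)
Lemma gcore_quotient (gT : finGroupType) (G K A : {group gT}) :
  K <| G -> K \subset A -> A \subset G ->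
  gcore (A / K) (G / K) = gcore A G / K.
Proof.
move=> nsKG sKA sAG; apply/eqP; rewrite eqEsubset; apply/andP; split.
  have nsCG : gcore (A / K) (G / K) <| G / K.
    by rewrite gcore_normal ?quotientS.
  have [L defL sKL nsLG] := inv_quotientN nsKG nsCG.
  rewrite /= in defL; rewrite defL quotientS //.
  apply: gcore_max; last exact: normal_norm.
  rewrite -(quotientSGK _ sKA) -?defL ?gcore_sub //.
  exact: subset_trans (normal_sub nsLG) (normal_norm nsKG).
by apply: gcore_max; [rewrite quotientS ?gcore_sub | rewrite quotient_norms ?gcore_norm].
Qed.

(** A trivial intersection would force [A * A :^ g = G] by counting. Writing [g] as [a * b ^ g] then
    gives [g = b * a] in [A], so [A] is trivial, and so is [G]. *)
Lemma index_le_card_nonTI (gT : finGroupType) (G A : {group gT}) (g : gT) :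
  A \proper G -> #|G : A| <= #|A| -> g \in G -> A :&: A :^ g != 1.
Proof.
move=> /andP[sAG] + leGA Gg; apply: contra => /eqP TI.
have defG : A * A :^ g = G.
  apply/eqP; rewrite eqEcard mul_subG ?conj_subG //=.
  by rewrite TI_cardMg // cardJg -(Lagrange sAG) leq_mul2l leGA orbT.
have /mulsgP[a _ Aa /imsetP[b Ab ->] eq_g] : g \in A * A :^ g by rewrite defG.
have Ag : g \in A.
  suff -> : g = b * a by apply: groupM.
  have agb : a * g^-1 * b = 1.
    by apply: (mulIg g); rewrite mul1g {3}eq_g conjgE !mulgA.
  apply/invg_inj/(mulgI a)/(mulIg b).
  by rewrite agb invMg mulKVg mulVg.
have A1 : A :=: 1 by rewrite -(setIid A) -{2}(conjGid Ag).
move: leGA; rewrite A1 indexg1 cards1 => leG1.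
by rewrite -(card_le1_trivg leG1).
Qed.

(** * Lucchini's theorem: the core-free case *)

Section LucchiniStep.

Variables (gT : finGroupType) (G A : {group gT}).

(** All group types are allowed because this is applied to the quotient [G / E] as well as to a
    subgroup of [G]. *)
Hypothesis IH : forall (rT : finGroupType) (H B : {group rT}),
  #|H| < #|G| -> cyclic B -> B \proper H -> #|B : gcore B H| < #|H : B|.

Hypotheses (cycA : cyclic A) (prAG : A \proper G) (coreA1 : gcore A G = 1).

Let sAG : A \subset G. Proof. exact: proper_sub. Qed.
Let cAA : abelian A. Proof. exact: cyclic_abelian. Qed.

Lemma normal_sub_corefree (N : {group gT}) : N <| G -> N \subset A -> N :=: 1.
Proof.
by move=> nsNG sNA; apply/trivgP; rewrite -coreA1 gcore_max ?normal_norm.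
Qed.

(** Zenkov's theorem applies to [A] and a conjugate of [A] meeting it in least order; this
    intersection is nontrivial. *)
Lemma cyclic_meet_Fitting : #|G : A| <= #|A| -> A :&: 'F(G) != 1.
Proof.
move=> leGA.
have [g Gg min_g] := @arg_minnP _ 1 [in G] (fun g => #|A :&: A :^ g|) (group1 G).
set B := (A :^ g)%G.
have /= ntM := index_le_card_nonTI _ _ _ _ prAG leGA Gg.
have [|p p_pr pM] := @pdivP #|A :&: A :^ g|; first by rewrite cardG_gt1.
have [x Mx ox] := Cauchy p_pr pM.
have Opx : x \in 'O_p(G).
  apply: (zenkov _ p G A B) => //.
  - by rewrite abelianJ.
  - by rewrite conj_subG.
  - move=> y Gy /= sAB.
    have /eqP-> // : A :&: (A :^ g) :^ y == A :&: A :^ g.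
    by rewrite eqEcard sAB -conjsgM min_g //= groupM.
  by rewrite /p_elt ox pnat_id.
apply: contraTneq p_pr => AF1.
have /set1P x1 : x \in [1 gT].
  rewrite -AF1 inE (subsetP (subsetIl _ _) _ Mx) /=.
  by rewrite (subsetP (pcore_sub p 'F(G))) // p_core_Fitting.
by rewrite -ox x1 order1.
Qed.

Variables (E : {group gT}) (p : nat).
Hypotheses (minE : minnormal E G) (sEF : E \subset 'F(G)) (abelE : p.-abelem E)
  (leGA : #|G : A| <= #|A|).

Let ntE : E :!=: 1. Proof. by have /mingroupp/andP[] := minE. Qed.

Let nsEG : E <| G.
Proof.
rewrite /normal (subset_trans sEF) ?Fitting_sub //.
by have /mingroupp/andP[] := minE.
Qed.

Let nEA : A \subset 'N(E).
Proof. exact: subset_trans sAG (normal_norm nsEG). Qed.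

Let cEE : abelian E. Proof. exact: abelem_abelian abelE. Qed.

Lemma minnormal_sub_or_TI (N : {group gT}) :
  N <| G -> E \subset N \/ E :&: N = 1.
Proof.
move=> nsNG; have [-> | ntEN] := eqVneq (E :&: N) 1; [by right | left].
have /mingroupP[_ min] := minE.
rewrite -(min (E :&: N)%G) ?subsetIl ?subsetIr //= ntEN.
exact: normal_norm (normalI nsEG nsNG).
Qed.

(** A nontrivial normal subgroup of the nilpotent group ['F(G)] meets its center, so minimality puts
    [E] inside that center. *)
Lemma minnormal_cent_Fitting : 'F(G) \subset 'C(E).
Proof.
have nsZG : 'Z('F(G)) <| G by rewrite gFnormal_trans ?Fitting_normal.
have nsEF : E <| 'F(G) by rewrite (normalS _ (Fitting_sub G)).
case: (minnormal_sub_or_TI [group of 'Z('F(G))] nsZG) => [sEZ | TI].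
  by rewrite centsC (subset_trans sEZ) ?subsetIr.
by have:= meet_center_nil (Fitting_nil G) nsEF ntE; rewrite TI eqxx.
Qed.

(** [A] and [E] both centralize [A :&: 'F(G)]. If they generated [G], this nontrivial subgroup of
    [A] would be normal in [G]. *)
Lemma joing_proper : A <*> E \proper G.
Proof.
rewrite properEneq join_subG sAG (normal_sub nsEG) !andbT.
have := cyclic_meet_Fitting leGA; apply: contraNneq => defG.
apply/eqP/normal_sub_corefree; last exact: subsetIl.
have : A <*> E \subset 'C(A :&: 'F(G)).
  rewrite join_subG centsC subIset ?[A \subset _]cAA //= centsC.
  by rewrite subIset // minnormal_cent_Fitting orbT.
by rewrite defG => cAF; rewrite /normal subIset ?sAG // cents_norm.
Qed.

(** [L / E] is the core of [AE / E] in [G / E], and [B] is the part of [A] inside [L]. *)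
Let AE := (A <*> E)%G.
Let L := [group of gcore AE G].
Let B := (A :&: L)%G.

Let defAE : A * E = AE. Proof. by rewrite /= norm_joinEl. Qed.
Let sAEG : AE \subset G. Proof. exact: proper_sub joing_proper. Qed.
Let sEL : E \subset L.
Proof. by rewrite gcore_max ?joing_subr ?normal_norm. Qed.
Let sLAE : L \subset AE. Proof. exact: gcore_sub. Qed.
Let nsLG : L <| G. Proof. exact: gcore_normal. Qed.
Let sLG : L \subset G. Proof. exact: normal_sub. Qed.

Let defL : B * E = L.
Proof. by rewrite /= setIC group_modr // defAE; apply/setIidPl. Qed.

Let cBB : abelian B. Proof. exact: abelianS (subsetIl _ _) cAA. Qed.

(* IH for A E / E in G / E bounds |A E : L| = |A : B| by |G : A E|. *)
Lemma card_gcore_joing : #|L| < #|B| ^ 2.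
Proof.
have ltij : #|AE : L| < #|G : AE|.
  have ltGE : #|G / E| < #|G| by rewrite ltn_quotient ?normal_sub.
  have prAE : AE / E \proper G / E.
    rewrite quotient_proper ?joing_proper // /normal joing_subr.
    by rewrite join_subG nEA normG.
  have cycAE : cyclic (AE / E).
    by rewrite /= quotientYidr // quotient_cyclic.
  have:= IH _ (G / E)%G (AE / E)%G ltGE cycAE prAE.
  have nEG := normal_norm nsEG.
  rewrite gcore_quotient ?joing_subr // (index_quotient_eq _ sAEG) //; last first.
    by rewrite subIset // joing_subr orbT.
  rewrite (index_quotient_eq _ sLAE) ?(subset_trans sAEG) //.
  exact: subset_trans (subsetIr _ _) sEL.
(* Compare the product formulas for [A * E] and [B * E], where [B :&: E = A :&: E]. *)
have cardAE : (#|A| * #|L| = #|AE| * #|B|)%N.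
  have defBE : B :&: E = A :&: E by rewrite /= -setIA (setIidPr sEL).
  have := mul_cardG A E; have := mul_cardG B E.
  rewrite defBE defL defAE => cardBE cardAE.
  apply/eqP; rewrite -(eqn_pmul2r (cardG_gt0 (A :&: E))) -mulnA -cardBE.
  by rewrite (mulnCA #|A|) cardAE mulnCA mulnA.
have cardA : #|A| = (#|B| * #|AE : L|)%N.
  apply/eqP; rewrite -(eqn_pmul2r (cardG_gt0 L)) cardAE -(Lagrange sLAE).
  by rewrite -mulnA mulnC (mulnC #|B|).
(* With i = |AE : L| < j = |G : AE|, we have |L| i j = |G| <= |A|^2 = |B|^2 i^2; cancel one i. *)
rewrite -(ltn_pmul2r (indexg_gt0 G AE)).
have leLj : #|L| * #|G : AE| <= #|B| ^ 2 * #|AE : L|.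
  rewrite -(leq_pmul2r (indexg_gt0 AE L)) mulnAC !Lagrange // -mulnA mulnn.
  by rewrite -expnMn -cardA -(Lagrange sAG) leq_mul2l leGA orbT.
by apply: leq_ltn_trans leLj _; rewrite ltn_pmul2l ?expn_gt0 ?cardG_gt0.
Qed.

(* Otherwise L = B E is abelian, and since E has exponent p, the p-th powers
   of B form a subgroup normal in G. *)
Lemma minnormal_not_central : ~~ (E \subset 'Z(L)).
Proof.
apply/negP=> sEZ.
have cLL : abelian L.
  have sEC : E \subset 'C(L) := subset_trans sEZ (subsetIr _ _).
  rewrite -defL abelianM cBB cEE /=.
  exact: subset_trans sEC (centS (subsetIr A L)).
have /cyclicP[b defB] : cyclic B by apply: cyclicS cycA; apply: subsetIl.
have Bb : b \in B by rewrite defB cycle_id.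
have Lb : b \in L by have [] := setIP Bb.
have [p_pr _ _] := pgroup_pdiv (abelem_pgroup abelE) ntE.
have bp1 : b ^+ p = 1.
  apply/eqP; rewrite -cycle_eq1; apply/eqP/normal_sub_corefree; last first.
    by rewrite cycle_subG groupX //; have [] := setIP Bb.
  rewrite /normal cycle_subG groupX ?(subsetP sLG) //=.
  apply/subsetP=> g Gg; rewrite inE -cycleJ cycle_subG conjXg.
  have : b ^ g \in B * E by rewrite defL memJ_norm // (subsetP (normal_norm nsLG)).
  case/mulsgP=> c e; rewrite defB => /cycleP[i ->] Ee ->.
  rewrite expgMn; last first.
    by apply: (centsP cLL); rewrite ?groupX // (subsetP sEL).
  have [_ /(_ e Ee)->] := abelemP p_pr abelE.
  by rewrite mulg1 -expgM mulnC expgM mem_cycle.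
have leBp : #|B| <= p.
  by rewrite defB dvdn_leq ?prime_gt0 // order_dvdn bp1.
(* The index is a power of p, and it is not 1 since [E] is not inside [A]. Hence |L| = |B| |E : B|
   >= |B|^2, against [card_gcore_joing]. *)
have lepI : p <= #|E : B|.
  have pEB : p.-nat #|E : B|.
    exact: pnat_dvd (dvdn_indexg _ _) (abelem_pgroup abelE).
  have ntEB : #|E : B| != 1%N.
    apply: contra ntE; rewrite indexg_eq1 => sEB.
    by rewrite (normal_sub_corefree E nsEG) // (subset_trans sEB) ?subsetIl.
  have [k ek] := p_natP pEB; rewrite ek in ntEB *.
  by case: k {ek} ntEB => // k _; rewrite expnS leq_pmulr ?expn_gt0 ?prime_gt0.
have := card_gcore_joing; rewrite -defL -LagrangeMl ltnNge expnS expn1 leq_mul2l.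
by rewrite (leq_trans leBp lepI) orbT.
Qed.

(* Now 'Z(L) is cyclic, so A meets it trivially, and B acts faithfully on E;
   applying IH to B in L gives a nontrivial core, which centralizes E. *)
Lemma lucchini_contradiction : False.
Proof.
have nsZG : 'Z(L) <| G by rewrite gFnormal_trans.
case: (minnormal_sub_or_TI [group of 'Z(L)] nsZG) => [|TI].
  by apply/negP/minnormal_not_central.
(* ['Z(L)] embeds in [L / E], a quotient of the cyclic group [B]. *)
have cycZ : cyclic 'Z(L).
  have nEZ : 'Z(L) \subset 'N(E).
    exact: subset_trans (normal_sub nsZG) (normal_norm nsEG).
  rewrite (isog_cyclic (quotient_isog nEZ TI)).
  have cycLE : cyclic (L / E).
    rewrite -defL quotientMidr quotient_cyclic //.
    by apply: cyclicS cycA; apply: subsetIl.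
  exact: cyclicS (quotientS E (center_sub L)) cycLE.
have AZ1 : A :&: 'Z(L) = 1.
  apply: normal_sub_corefree (subsetIl _ _).
  by apply: char_normal_trans nsZG; rewrite sub_cyclic_char ?subsetIr.
have CBE : B :&: 'C(E) = 1.
  have : B :&: 'C(E) \subset 'C(B * E) by rewrite centM setSI.
  rewrite defL => cBL; apply/trivgP; rewrite -AZ1 !subsetI cBL andbT.
  have sBCB : B :&: 'C(E) \subset B := subsetIl _ _.
  by apply/andP; split; apply: subset_trans sBCB _; rewrite ?subsetIl ?subsetIr.
have prBL : B \proper L.
  rewrite properEneq subsetIr andbT; apply: contraNneq ntE => eqBL.
  apply/eqP/normal_sub_corefree => //.
  by apply: subset_trans (subsetIl A L); rewrite [A :&: L]eqBL.
have ltLG : #|L| < #|G|.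
  by apply: proper_card; apply: sub_proper_trans sLAE joing_proper.
have cycB : cyclic B by apply: cyclicS cycA; apply: subsetIl.
have := IH _ L B ltLG cycB prBL.
have -> : gcore B L = 1.
  apply/trivgP; rewrite -CBE subsetI gcore_sub /=.
  have nNE : E \subset 'N(gcore B L) := subset_trans sEL (gcore_norm B L).
  have nEN : gcore B L \subset 'N(E).
    exact: subset_trans (gcore_sub B L) (subset_trans (subsetIl _ _) nEA).
  (* The core and [E] normalize each other, so their commutator lies in both; as [E] is abelian, it
     lies in [B :&: 'C(E)]. *)
  apply/commG1P/trivgP; rewrite -CBE subsetI.
  have sRE : [~: gcore B L, E] \subset E by rewrite commg_subr.
  rewrite (subset_trans sRE cEE) andbT.
  by rewrite (subset_trans _ (gcore_sub B L)) ?commg_subl.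
have := card_gcore_joing; rewrite indexg1 -(Lagrange (proper_sub prBL)).
rewrite expnS expn1 ltn_pmul2l ?cardG_gt0 //.
by move=> lt1 lt2; have:= ltn_trans lt1 lt2; rewrite ltnn.
Qed.

End LucchiniStep.

(** * Lucchini's theorem: reduction to a trivial core *)

Theorem lucchini (gT : finGroupType) (G A : {group gT}) :
  cyclic A -> A \proper G -> #|A : gcore A G| < #|G : A|.
Proof.
have [n] := ubnP #|G|; elim: n => // n IHn in gT G A * => /ltnSE leGn cycA prAG.
have IH (rT : finGroupType) (H B : {group rT}) :
    #|H| < #|G| -> cyclic B -> B \proper H -> #|B : gcore B H| < #|H : B|.
  by move=> ltHG; apply: IHn; apply: leq_trans leGn.
have sAG := proper_sub prAG.
have [core1 | ntK] := eqVneq (gcore A G) 1.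
  rewrite core1 indexg1 ltnNge; apply/negP=> leGA.
  have ntF : 'F(G) != 1.
    have := cyclic_meet_Fitting gT G A cycA prAG leGA.
    by apply: contraNneq => ->; rewrite setIg1.
  have [E minE sEF] := minnormal_exists ntF (gFnorm _ G).
  have [_ _ /is_abelemP[p _ abelE]] :=
    minnormal_solvable minE sEF (nilpotent_sol (Fitting_nil G)).
  exact: (lucchini_contradiction gT G A IH cycA prAG core1 E p).
pose K := [group of gcore A G].
have nsKG : K <| G by apply: gcore_normal.
have sKA : K \subset A by apply: gcore_sub.
have nKG := normal_norm nsKG.
have := IH _ (G / K)%G (A / K)%G.
rewrite ltn_quotient ?normal_sub // quotient_cyclic // => /(_ isT isT).
rewrite quotient_proper ?(normalS sKA sAG) // prAG => /(_ isT).
rewrite gcore_quotient // (index_quotient_eq _ sAG) ?subIset ?sKA ?orbT //.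
by rewrite index_quotient_eq ?subsetIr // (subset_trans sAG).
Qed.

(** * Core-free subgroups of p-groups and nilpotent groups *)

(** If every conjugate of [H] met [<[c]>], each would contain its unique subgroup of order p, which
    would lie in the core. *)
Lemma pgroup_corefree_order (gT : finGroupType) (p : nat) (P H : {group gT}) c :
  p.-group P -> H \proper P -> gcore H P = 1 -> c \in H ->
  #[c] * p <= #|P : H|.
Proof.
move=> pP prHP core1 Hc; have sHP := proper_sub prHP.
have [eqHP | [M maxM sHM]] := maximal_exists sHP.
  by rewrite eqHP properxx in prHP.
have [a Pa TI] : exists2 a, a \in P & <[c]> :&: H :^ a = 1.
  apply/'exists_in_eqP; apply: contraT => noTI.
  have ntI b : b \in P -> <[c]> :&: H :^ b != 1.
    by move=> Pb; apply: contra noTI => TI; apply/exists_inP; exists b.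
  have ntc : <[c]> != 1.
    by have := ntI 1 (group1 P); apply: contraNneq => ->; rewrite setI1g.
  have pc : p.-group <[c]> by apply: pgroupS pP; rewrite cycle_subG (subsetP sHP).
  have [p_pr pdvc _] := pgroup_pdiv pc ntc.
  have [z cz oz] := Cauchy p_pr pdvc.
  suff : <[z]> \subset gcore H P.
    by rewrite core1 cycle_subG => /set1P z1; rewrite -oz z1 order1 in p_pr.
  apply/bigcapsP=> a Pa.
  have pI : p.-group (<[c]> :&: H :^ a) by apply: pgroupS pc; apply: subsetIl.
  have [_ pdvI _] := pgroup_pdiv pI (ntI a Pa).
  have [y /setIP[cy Hy] oy] := Cauchy p_pr pdvI.
  have /eqP-> : <[z]> == <[y]>.
    by rewrite (eq_subG_cyclic (cycle_cyclic c)) ?cycle_subG // -!orderE oz oy.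
  by rewrite cycle_subG.
have nsMP := p_maximal_normal pP maxM.
have sHaM : H :^ a \subset M by rewrite -(normsP (normal_norm nsMP) a Pa) conjSg.
have sCHM : <[c]> * H :^ a \subset M.
  by rewrite mul_subG // cycle_subG (subsetP sHM).
have := subset_leq_card sCHM; rewrite TI_cardMg // cardJg -orderE => leM.
rewrite -(leq_pmul2r (cardG_gt0 H)) [leqRHS]mulnC Lagrange //.
rewrite -(Lagrange (normal_sub nsMP)) (p_maximal_index pP maxM) mulnAC.
by rewrite leq_mul2r leM orbT.
Qed.

(** [G] is the product of ['O_pi(G)] and ['O_pi^'(G)], and the latter centralizes [H]. *)
Lemma gcore_nilpotent (gT : finGroupType) (pi : nat_pred) (G H : {group gT}) :
  nilpotent G -> H \subset 'O_pi(G) -> gcore H 'O_pi(G) \subset gcore H G.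
Proof.
move=> nilG sHP; apply: gcore_max; first exact: gcore_sub.
have /dprodP[_ defG cPQ _] := nilpotent_pcoreC pi nilG.
suff: 'O_pi(G) * 'O_pi^'(G) \subset 'N(gcore H 'O_pi(G)) by rewrite defG.
rewrite mul_subG ?gcore_norm // cents_norm //.
by rewrite (subset_trans cPQ) // centS // (subset_trans (gcore_sub _ _)).
Qed.

(** * Structure of dihedral groups *)

(** The relations only bound [#[c]] by m; equality follows from 2m = |H| <= [#[c] * #[d]]. *)
Lemma dihedral_generators (gT : finGroupType) (H : {group gT}) (m : nat) :
  1 < m -> H \isog 'D_(m.*2) ->
  exists c d, [/\ H :=: <[c]> <*> <[d]>, #[c] = m, d ^+ 2 = 1 & c ^ d = c^-1].
Proof.
move=> m_gt1 isoH; have oH := card_isog isoH.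
rewrite card_dihedral // in oH.
have := isog_hom isoH; rewrite Grp_dihedral // => /existsP[[c d]] /=.
rewrite !xpair_eqE => /and4P[/eqP defH /eqP cm1 /eqP d2 /eqP cd].
exists c, d; split=> //.
have nCd : <[d]> \subset 'N(<[c]>).
  by rewrite cycle_subG inE -cycleJ cd cycle_subG groupV cycle_id.
apply/eqP; rewrite eqn_leq dvdn_leq ?order_dvdn ?cm1 ?(ltnW m_gt1) //=.
rewrite -(leq_pmul2r (ltn0Sn 1)) muln2 -oH -defH /= norm_joinEr //.
have le2 : #[d] <= 2 by rewrite dvdn_leq // order_dvdn d2.
apply: leq_trans (_ : #[c] * #[d] <= _); last by rewrite leq_mul2l le2 orbT.
by rewrite mul_cardG leq_pmulr ?cardG_gt0.
Qed.

(** By nilpotency the odd part of [c] commutes with [d], which also inverts it, so it is trivial. *)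
Lemma nilpotent_dihedral_2group (gT : finGroupType) (H : {group gT}) c d :
  nilpotent H -> H :=: <[c]> <*> <[d]> -> d ^+ 2 = 1 -> c ^ d = c^-1 ->
  2.-group H.
Proof.
move=> nilH defH d2 cd.
have nCd : <[d]> \subset 'N(<[c]>).
  by rewrite cycle_subG inE -cycleJ cd cycle_subG groupV cycle_id.
have [Hc Hd] : c \in H /\ d \in H.
  by rewrite defH; split; apply: mem_gen; rewrite inE cycle_id ?orbT.
have p_d : 2.-elt d by rewrite /p_elt (@pnat_dvd _ 2) // order_dvdn d2.
pose e := c.`_2^'.
have p'_e : 2^'.-elt e by apply: p_elt_constt.
have ce : <[e]> \subset <[c]> by rewrite cycle_subG cycle_constt.
have cde : commute e d.
  apply/cent1P; rewrite -cent_cycle -cycle_subG.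
  apply: (sub_nilpotent_cent2 nilH); rewrite ?cycle_subG //.
    by rewrite (subsetP _ _ (cycle_constt _ _)) // cycle_subG.
  exact: pnat_coprime p_d p'_e.
have ed : e ^ d = e^-1 by rewrite /e -consttJ cd consttV.
have eV : e = e^-1 by rewrite -ed conjgE cde mulKg.
have p_e : 2.-elt e.
  have e2 : e ^+ 2 = 1 by rewrite expgS expg1 {1}eV mulVg.
  by rewrite /p_elt (@pnat_dvd _ 2) // order_dvdn e2.
have /constt1P : c.`_2^' = 1.
  by apply/eqP; rewrite -order_eq1; apply/eqP; apply: pnat_1 p_e p'_e.
rewrite p_eltNK => p_c.
by rewrite defH norm_joinEr // pgroupM; apply/andP.
Qed.

(** * Point stabilizers and the order bounds *)

(** By transitivity the conjugates of one stabilizer are all the stabilizers, so the core fixes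
    every point. *)
Lemma stabilizer_corefree (gT : finGroupType) (G : {group gT}) (T : finType)
    (to : action G T) (x : T) :
  [faithful G, on [set: T] | to] -> [transitive G, on [set: T] | to] ->
  gcore 'C_G[x | to] G = 1.
Proof.
move=> faithG transG; apply/trivgP; apply: subset_trans faithG.
apply/subsetP=> h /bigcapP hG.
have Gh : h \in G by have := hG 1 (group1 G); rewrite conjsg1 => /setIP[].
rewrite !inE Gh; apply/subsetP=> t _; rewrite inE.
have [g Gg ->] := atransP2in (subxx G) transG (in_setT x) (in_setT t).
have := hG g Gg; rewrite conjIg -astab1_act_in // => /setIP[_ /astab_act->] //.
by rewrite inE.
Qed.

Theorem theorem1p1 (gT : finGroupType) (G : {group gT}) (T : finType)
    (to : action G T) (n : nat) (x : T)
    (degree_n : #|T| = n) (n_gt1 : (1 < n)%N)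
    (faithG : [faithful G, on [set: T] | to])
    (transG : [transitive G, on [set: T] | to])
    (dihH : is_dihedral 'C_G[x | to]) :
  [/\ (#|G| < 4 * n ^ 2)%N,
      nilpotent G -> (#|G| <= n ^ 2)%N
    & (#|G| <= n ^ 2)%N <-> (#|G| >= #|'C_G[x | to]| ^ 2)%N].
Proof.
have core1 := stabilizer_corefree _ _ _ _ x faithG transG.
have orbitT : orbit to G x = [set: T] by apply: (atransPin (subxx G) transG).
have indexH : #|G : 'C_G[x | to]| = n.
  by rewrite -card_orbit_in // orbitT cardsT.
move: core1 indexH dihH; rewrite -[_ :&: _]/(gval 'C_G[x | to]%G).
set H := 'C_G[x | to]%G => core1 indexH dihH.
have sHG : H \subset G by apply: subsetIl.
have n_gt0 := ltnW n_gt1.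
have cardG : #|G| = (n * #|H|)%N by rewrite mulnC -indexH Lagrange.
case: dihH => m m_gt1 isoH; have := card_isog isoH.
rewrite card_dihedral // -muln2 => cardH.
have [c [d [defH oc d2 cd]]] := dihedral_generators _ _ _ m_gt1 isoH.
have sCH : <[c]> \subset H by rewrite defH joing_subl.
have cardC : #|<[c]>| = m by [].
have cardGC : #|G : <[c]>| = (n * 2)%N.
  apply/eqP; rewrite -(eqn_pmul2l (cardG_gt0 <[c]>)) Lagrange ?(subset_trans sCH) //.
  by rewrite cardG cardH cardC mulnCA.
have coreC1 : gcore <[c]> G = 1.
  by apply/trivgP; rewrite -core1 gcore_max ?gcore_norm // (subset_trans (gcore_sub _ _)).
have lt_m_2n : m < n * 2.
  rewrite -cardC -cardGC -[#|<[c]>|](indexg1 <[c]>) -coreC1.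
  apply: lucchini (cycle_cyclic c) _.
  rewrite properEcard (subset_trans sCH) //= cardG cardH cardC.
  rewrite -{1}(mul1n m) mulnCA mulnC ltn_pmul2l ?(ltnW m_gt1) //.
  by rewrite (leq_trans n_gt1) ?leq_pmulr.
split.
- rewrite cardG cardH expnS expn1 (mulnCA 4) ltn_pmul2l // mulnC.
  by rewrite -[4]/(2 * 2)%N -mulnA ltn_pmul2l // mulnC.
- move=> nilG.
  have pH : 2.-group H.
    exact: nilpotent_dihedral_2group (nilpotentS sHG nilG) defH d2 cd.
  set P := [group of 'O_2(G)].
  have sHP : H \subset P.
    by rewrite (sub_normal_Hall (nilpotent_pcore_Hall _ nilG)) ?pcore_normal.
  (* Otherwise [H] is normal in [G], hence trivial, although its order is 2m. *)
  have prHP : H \proper P.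
    rewrite properEneq sHP andbT; apply/eqP=> eqHP.
    have : H :=: 1.
      by apply/trivgP; rewrite -core1 gcore_max // eqHP gFnorm.
    move=> H1; have := cardH; rewrite H1 cards1 => /eqP.
    by case: (m) m_gt1 => [|[]].
  have coreP1 : gcore H P = 1.
    by apply/trivgP; rewrite -core1 gcore_nilpotent.
  have leHn : #|H| <= n.
    have Hc : c \in H by rewrite -cycle_subG.
    have := pgroup_corefree_order _ _ _ _ _ (pcore_pgroup 2 G) prHP coreP1 Hc.
    rewrite oc -cardH => /leq_trans; apply; rewrite -indexH.
    by rewrite dvdn_leq ?indexg_gt0 // indexSg ?pcore_sub.
  by rewrite cardG expnS expn1 leq_mul2l leHn orbT.
(* As |G| = n |H|, both inequalities say |H| <= n. *)
- by rewrite cardG -!mulnn leq_pmul2l // leq_pmul2r ?cardG_gt0.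
Qed.
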